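(* Let $p\ge3$ and let $\tau=\tau_1\cdots\tau_p\in S_p$ with $\tau_1=1$, $\tau_p=s$ where $2\le s<p$, and suppose $\tau$ has the minimal overlapping property. Define the polynomials $\mathrm{IU}_{\tau,n}(q,z)$ by \[ 1+\sum_{n\ge1}\mathrm{IU}_{\tau,n}(q,z)\frac{t^n}{[n]_q!}=\frac{1}{\mathrm{INM}_\tau(t,q,z)}, \] and set $\mathrm{IU}_{\tau,0}(q,z)=1$. Then $\mathrm{IU}_{\tau,1}(q,z)=-z$, and for all $n\ge2$, \[ \mathrm{IU}_{\tau,n}(q,z)=(1-z)\,\mathrm{IU}_{\tau,n-1}(q,z)-z^{\mathrm{des}(\tau)}q^{\mathrm{inv}(\tau)}\begin{bmatrix} n-s\\ p-s\end{bmatrix}_q\mathrm{IU}_{\tau,n-p+1}(q,z), \] where the second term is interpreted as $0$ whenever $n<p$ (the $q$-binomial coefficient then vanishes).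
   Context: For $\sigma\in S_n$: $\mathrm{des}(\sigma)=|\{i:\sigma_i>\sigma_{i+1}\}|$, $\mathrm{inv}(\sigma)=|\{(i,k):i<k,\sigma_i>\sigma_k\}|$. $\mathrm{red}(w)$ replaces the $i$-th smallest entry of a sequence of distinct integers by $i$; $\sigma$ has a $\tau$-match at position $i$ if $\mathrm{red}(\sigma_i\cdots\sigma_{i+p-1})=\tau$; $\mathcal{NM}_n(\tau)$ is the set of $\sigma\in S_n$ with no $\tau$-match. $\tau\in S_p$ ($p\ge3$) is minimal overlapping if the smallest $i$ such that some $\sigma\in S_i$ has exactly two $\tau$-matches is $2p-1$. $[n]_q=1+q+\cdots+q^{n-1}$, $[n]_q!=[1]_q\cdots[n]_q$, $[0]_q!=1$, and $\begin{bmatrix} m\\ k\end{bmatrix}_q=\frac{[m]_q!}{[k]_q![m-k]_q!}$ for $0\le k\le m$ and $0$ otherwise. $\mathrm{INM}_{\tau,n}(q,z)=\sum_{\sigma\in\mathcal{NM}_n(\tau)}z^{\mathrm{des}(\sigma)+1}q^{\mathrm{inv}(\sigma)}$ and $\mathrm{INM}_\tau(t,q,z)=1+\sum_{n\ge1}\frac{t^n}{[n]_q!}\mathrm{INM}_{\tau,n}(q,z)$. *)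

(* Defs.v *)
From HB Require Import structures.
From mathcomp Require Import all_boot all_order all_fingroup all_algebra.
From mathcomp Require Import ring.

Set Implicit Arguments.
Unset Strict Implicit.
Unset Printing Implicit Defensive.

Import Order.TTheory GRing.Theory Num.Theory.

(* A permutation s : 'S_n acts on {0, ..., n-1}; [word s] is the one-line
   notation s_1 ... s_n with values in {1, ..., n}, so that s_i is
   [nth 0 (word s) i.-1]. *)
Definition word (n : nat) (s : 'S_n) : seq nat := [seq (s i).+1 | i <- enum 'I_n].

Definition ndes (n : nat) (s : 'S_n) : nat :=
  #|[set i : 'I_n.-1 | nth 0 (word s) i > nth 0 (word s) i.+1]|.

Definition ninv (n : nat) (s : 'S_n) : nat :=
  #|[set x : 'I_n * 'I_n | (x.1 < x.2) && (nth 0 (word s) x.1 > nth 0 (word s) x.2)]|.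

(* The i-th smallest entry x of a sequence of distinct integers is the one
   with exactly i entries <= x. *)
Definition red (w : seq nat) : seq nat :=
  [seq count (fun y => y <= x) w | x <- w].

(* Positions are counted from 0.  If fewer than p letters remain from
   position i on, the two words have different sizes and there is no match. *)
Definition match_at (p n : nat) (tau : 'S_p) (s : 'S_n) (i : nat) : bool :=
  red (take p (drop i (word s))) == word tau.

Definition nmatches (p n : nat) (tau : 'S_p) (s : 'S_n) : nat :=
  #|[set i : 'I_n | match_at tau s i]|.

Definition NM (p : nat) (tau : 'S_p) (n : nat) : {set 'S_n} :=
  [set s : 'S_n | nmatches tau s == 0].

Definition minimal_overlapping (p : nat) (tau : 'S_p) : Prop :=
  let two_matches i := exists s : 'S_i, nmatches tau s = 2 in
  two_matches (2 * p - 1) /\ forall i, two_matches i -> 2 * p - 1 <= i.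

Local Open Scope ring_scope.

(* Z[q][z]: the inner indeterminate is q, the outer one is z. *)
Notation Zqz := {poly {poly int}}.
Notation Qqz := {fraction Zqz}.
Definition qvar : Zqz := 'X%:P.
Definition zvar : Zqz := 'X.
Notation "x %:F" := (@tofrac _ x) : ring_scope.

Definition qint (n : nat) : Zqz := \sum_(i < n) qvar ^+ i.
Definition qfact (n : nat) : Zqz := \prod_(i < n) qint i.+1.
Definition qbinom (m k : nat) : Qqz :=
  if (k <= m)%N then (qfact m)%:F / ((qfact k)%:F * (qfact (m - k))%:F) else 0.

Definition INMn (p : nat) (tau : 'S_p) (n : nat) : Zqz :=
  \sum_(s in NM tau n) zvar ^+ (ndes s).+1 * qvar ^+ ninv s.

(* Formal power series in t over Q(q,z) are represented by their coefficient
   sequences nat -> Qqz; [fps_mul] is the Cauchy product. *)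
Definition fps_one (n : nat) : Qqz := (n == 0)%:R.
Definition fps_mul (f g : nat -> Qqz) (n : nat) : Qqz :=
  \sum_(k < n.+1) f k * g (n - k)%N.

(* 1 + \sum_(n >= 1) a n * t^n / [n]_q! *)
Definition qegf (a : nat -> Zqz) (n : nat) : Qqz :=
  if n == 0 then 1 else (a n)%:F / (qfact n)%:F.

Definition INM (p : nat) (tau : 'S_p) : nat -> Qqz := qegf (INMn tau).

Definition is_IU (p : nat) (tau : 'S_p) (IU : nat -> Zqz) : Prop :=
  IU 0 = 1 /\ fps_mul (qegf IU) (INM tau) =1 fps_one.

(* Polynomials IU_n as above exist: the q-binomial coefficients are polynomials
   (q-Pascal rule), so the recursion for the coefficients of the inverse series
   stays in Z[q][z]. *)
Fixpoint gauss (n k : nat) : Zqz :=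
  match n, k with
  | _, 0 => 1
  | 0, _.+1 => 0
  | n'.+1, k'.+1 => gauss n' k' + qvar ^+ k'.+1 * gauss n' k'.+1
  end.

Lemma qint_neq0 n : qint n.+1 != 0.
Proof.
have -> : qint n.+1 = (\sum_(i < n.+1) 'X^i)%:P.
  by rewrite rmorph_sum; apply: eq_bigr => i _; rewrite /qvar rmorphXn.
rewrite polyC_eq0; apply/eqP => /(congr1 (fun P : {poly int} => P.[1])).
rewrite horner_sum horner0.
under eq_bigr => i _ do rewrite hornerXn expr1n.
by rewrite sumr_const card_ord => /eqP; rewrite pnatr_eq0.
Qed.

Lemma qfact_neq0 n : qfact n != 0.
Proof. by apply/prodf_neq0 => i _; apply: qint_neq0. Qed.

Lemma qfactS n : qfact n.+1 = qfact n * qint n.+1.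
Proof. by rewrite /qfact big_ord_recr. Qed.

Lemma qfact0 : qfact 0 = 1.
Proof. by rewrite /qfact big_ord0. Qed.

Lemma qintD m n : qint (m + n) = qint m + qvar ^+ m * qint n.
Proof.
rewrite /qint big_split_ord /= mulr_sumr; congr (_ + _).
by apply: eq_bigr => i _; rewrite exprD.
Qed.

Lemma gauss_small n k : (n < k)%N -> gauss n k = 0.
Proof.
elim: n k => [|n IHn] [|k] //= lt_nk.
by rewrite !IHn ?mulr0 ?addr0 // ltnW.
Qed.

Lemma gauss_fact k m : gauss (k + m) k * (qfact k * qfact m) = qfact (k + m).
Proof.
have [n] := ubnP (k + m); elim: n k m => // n IHn [|k] m lt_n.
  by rewrite add0n; case: m {lt_n} => [|m] /=; rewrite qfact0 !mul1r.
rewrite addSn [qfact (k + m).+1]qfactS /= mulrDl.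
have lt1 : (k + m < n)%N by rewrite -ltnS -addSn.
have -> : gauss (k + m) k * (qfact k.+1 * qfact m) = qfact (k + m) * qint k.+1.
  by rewrite -IHn // qfactS; ring.
rewrite -addSn qintD mulrDr; congr (_ + _).
case: m lt_n lt1 => [|m] lt_n lt1.
  by rewrite addn0 gauss_small // /qint big_ord0 !mulr0 mul0r.
rewrite -addSnnS -(IHn k.+1 m) ?addSnnS // [qfact m.+1]qfactS; ring.
Qed.

Lemma gaussE n k : (k <= n)%N -> (gauss n k)%:F = qbinom n k.
Proof.
move=> le_kn; rewrite /qbinom le_kn -tofracM.
have := gauss_fact k (n - k); rewrite subnKC // => <-.
by rewrite [in RHS](tofracM (gauss n k)) mulfK // tofrac_eq0 mulf_neq0 ?qfact_neq0.
Qed.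

Lemma qegf_term (K : fieldType) (a b x y u : K) : u != 0 ->
  a / x * (b / y) = u / (x * y) * (a * b) / u.
Proof.
move=> u0; have -> : u / (x * y) * (a * b) = u * (a / x * (b / y)).
  by rewrite invfM; ring.
by rewrite [u * _]mulrC mulfK.
Qed.

Lemma is_IU_exists (p : nat) (tau : 'S_p) : exists IU, is_IU tau IU.
Proof.
pose next (l : seq Zqz) :=
  - \sum_(k < size l) gauss (size l) k * (l`_k * INMn tau (size l - k)).
pose l n := iter n (fun l => rcons l (next l)) [:: 1].
have size_l n : size (l n) = n.+1 by elim: n => //= n IHn; rewrite size_rcons IHn.
have nth_l n k : (k <= n)%N -> (l n)`_k = (l k)`_k.
  elim: n => [|n IHn]; first by rewrite leqn0 => /eqP->.
  rewrite leq_eqVlt ltnS => /predU1P[-> //|le_kn].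
  by rewrite /= nth_rcons size_l ltnS le_kn IHn.
exists (fun n => (l n)`_n); split=> // -[|n]; rewrite /fps_mul.
  by rewrite big_ord1 /INM /qegf mulr1.
have lS : (l n.+1)`_n.+1
    = - \sum_(k < n.+1) gauss n.+1 k * ((l k)`_k * INMn tau (n.+1 - k)).
  rewrite /= nth_rcons size_l ltnn eqxx /next size_l; congr (- _).
  by apply: eq_bigr => k _; rewrite nth_l // -ltnS.
have F0 m : (qfact m)%:F != 0 by rewrite tofrac_eq0 qfact_neq0.
have qegfE a m : a 0 = 1 \/ (0 < m)%N -> qegf a m = (a m)%:F / (qfact m)%:F.
  rewrite /qegf; case: m => [|m] //= [|//] ->.
  by rewrite qfact0 tofrac1 divr1.
rewrite big_ord_recr /= subnn mulr1 qegfE; last by right.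
rewrite lS tofracN mulNr rmorph_sum mulr_suml.
apply/eqP; rewrite subr_eq add0r; apply/eqP/eq_bigr => k _.
have le_kn : (k <= n.+1)%N by apply: ltnW.
rewrite qegfE; last by left.
rewrite /INM qegfE; last by right; rewrite subn_gt0.
rewrite !rmorphM [X in X * _ / _]gaussE // /qbinom le_kn.
exact: qegf_term.
Qed.

(* Main.v *)
(* Inclusion-exclusion over adjacent ascents (z = z and 1 = z + (1 - z)) and over
   tau-matches (0 = 1 - 1) writes the weight of a tau-avoiding word as a sum, over
   its nonempty prefixes, of a signed cluster weight of the prefix times the weight of
   the rest.  Summing q^inv over S_n turns prefix/suffix products into q-binomial
   convolutions, so IU_n is minus the sum of the cluster weights.  By minimal
   overlapping a cluster is a chain of ascents and tau-matches, consecutive ones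
   sharing exactly one letter; as tau starts with 1, its first letter is its minimum.
   Removing the first link is the recursion: if it is a match, the shared letter is
   s, and only the p - s larger letters of the match are free among n - s. *)
Require Import Defs.
From HB Require Import structures.
From mathcomp Require Import all_boot all_order all_fingroup all_algebra.
From mathcomp Require Import ring zify.

Set Implicit Arguments.
Unset Strict Implicit.
Unset Printing Implicit Defensive.

Import Order.TTheory GRing.Theory Num.Theory.
Local Open Scope ring_scope.

(** * Permutations as words, and insertion of a new smallest letter *)

Definition letters (n : nat) (s : 'S_n) : seq nat := [seq s i : nat | i <- enum 'I_n].

(** Letters start at 0, so shifting them by one frees 0 as a new minimum at position [i]; on
    permutations this is [lift_perm i ord0]. *)
Definition ins (i : nat) (w : seq nat) : seq nat :=
  take i (map S w) ++ 0%N :: drop i (map S w).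

Lemma size_letters n (s : 'S_n) : size (letters s) = n.
Proof. by rewrite size_map size_enum_ord. Qed.

Lemma letters_uniq n (s : 'S_n) : uniq (letters s).
Proof.
rewrite map_inj_uniq ?enum_uniq //.
by move=> i j /val_inj/perm_inj.
Qed.

Lemma nth_letters n (s : 'S_n) x0 (i : 'I_n) : nth x0 (letters s) i = s i.
Proof. by rewrite (nth_map i) ?size_enum_ord // nth_ord_enum. Qed.

Lemma wordE n (s : 'S_n) : word s = map S (letters s).
Proof. by rewrite -map_comp. Qed.

Lemma nth_word n (s : 'S_n) (i : 'I_n) : nth 0%N (word s) i = (s i).+1.
Proof. by rewrite wordE (nth_map 0%N) ?size_letters // nth_letters. Qed.

Lemma word_inj n : injective (@word n).
Proof.
move=> s t eq_st; apply/permP => i; apply/val_inj/succn_inj.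
by rewrite -!nth_word eq_st.
Qed.

Lemma size_ins i w : size (ins i w) = (size w).+1.
Proof.
by rewrite /ins size_cat /= addnS -size_cat cat_take_drop size_map.
Qed.

Lemma letters_lift n (i : 'I_n.+1) (s : 'S_n) :
  letters (lift_perm i ord0 s) = ins i (letters s).
Proof.
apply: (@eq_from_nth _ 0%N) => [|j]; rewrite size_letters ?size_ins ?size_letters //.
move=> lt_jn; have -> : j = Ordinal lt_jn by [].
rewrite nth_letters /ins nth_cat size_take size_map size_letters.
have lei : (i <= n)%N by rewrite -ltnS.
case: (unliftP i (Ordinal lt_jn)) => [k ->|->].
  rewrite lift_perm_lift /= /bump.
  have [le_ik|lt_ki] := leqP i k.
    have -> /= : (if (i < n)%N then val i else n) = i by case: ltngtP lei.
    rewrite add1n ltnNge leqW //= subSn //= nth_drop subnKC //.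
    by rewrite (nth_map 0%N) ?size_letters // nth_letters.
  have -> /= : (if (i < n)%N then val i else n) = i by case: ltngtP lei.
  rewrite add0n lt_ki nth_take //.
  by rewrite (nth_map 0%N) ?size_letters // nth_letters.
rewrite lift_perm_id.
have -> : (if (i < n)%N then val i else n) = i by case: ltngtP lei.
by rewrite ltnn subnn.
Qed.

Lemma ninvE n (s : 'S_n) :
  ninv s = (\sum_(i < n) \sum_(j < n) ((i < j) && (s j < s i)))%N.
Proof.
rewrite pair_big /= /ninv -sum1_card big_mkcond /=.
by apply: eq_bigr => -[i j] _ /=; rewrite inE /= !nth_word ltnS; case: ifP.
Qed.

(** The minimum at position [i] is inverted with each of the [i] letters before it and with none
    after it; all other pairs keep their order. *)
Lemma ninv_lift n (i : 'I_n.+1) (s : 'S_n) :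
  ninv (lift_perm i ord0 s) = (i + ninv s)%N.
Proof.
rewrite !ninvE (bigD1_ord i) //= big1 ?add0n; last first.
  by move=> j _; rewrite lift_perm_id ltn0 andbF.
under eq_bigr => j _.
  rewrite (bigD1_ord i) //= lift_perm_id lift_perm_lift /= /bump.
  under eq_bigr => k _ do rewrite lift_perm_lift !ltnS.
  over.
rewrite big_split /=; congr (_ + _)%N.
  have lei : (i <= n)%N by rewrite -ltnS.
  transitivity (\sum_(j < n) (j < i)%N)%N.
    apply: eq_bigr => j _; rewrite andbT; congr nat_of_bool.
    by case: (leqP i j) => ?; lia.
  transitivity (\sum_(j < n | j < i) 1)%N.
    by rewrite [RHS]big_mkcond /=; apply: eq_bigr => j _; case: ifP.
  by rewrite -(big_ord_widen _ (fun=> 1%N) lei) sum1_card card_ord.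
apply: eq_bigr => j _; apply: eq_bigr => k _.
by rewrite /bump; do 2 case: leqP => ?; congr (nat_of_bool (_ && _)); lia.
Qed.

Lemma reindex_lift n (i j : 'I_n.+1) (F : 'S_n.+1 -> Zqz) :
  \sum_(s : 'S_n.+1 | s i == j) F s = \sum_(s : 'S_n) F (lift_perm i j s).
Proof.
rewrite (reindex (lift_perm i j)) /=.
  by apply: eq_bigl => s; rewrite lift_perm_id eqxx.
(* Deletes position [k] and value [s k]; the default [l] is never reached, as [s] is injective. *)
pose u k (s : 'S_n.+1) l := odflt l (unlift (s k) (s (lift k l))).
have uK k (s : 'S_n.+1) l : lift (s k) (u k s l) = s (lift k l).
  rewrite /u; have := neq_lift k l.
  by rewrite -(can_eq (permK s)) => /unlift_some[] ? ? ->.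
have inj_u s : injective (u i s).
  apply: can_inj (u (s i) s^-1%g) _ => l.
  by rewrite {1}/u uK !permK liftK.
exists (fun s => perm (inj_u s)) => [s _ | s].
  by apply/permP => l; rewrite permE /u lift_perm_lift lift_perm_id liftK.
rewrite inE => /eqP si; apply/permP => l.
case: (unliftP i l) => [l'|] ->; rewrite ?lift_perm_id //.
by rewrite lift_perm_lift -si permE uK.
Qed.

(** * Sums of q^inv over S_n and their convolution *)

Definition invsum (n : nat) (f : seq nat -> Zqz) : Zqz :=
  \sum_(s : 'S_n) qvar ^+ ninv s * f (letters s).

Lemma eq_invsum n f g :
    (forall w, size w = n -> uniq w -> f w = g w) -> invsum n f = invsum n g.
Proof.
move=> eq_fg; apply: eq_bigr => s _.
by rewrite eq_fg ?size_letters ?letters_uniq.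
Qed.

Lemma invsum_eq0 n f : (forall w, size w = n -> f w = 0) -> invsum n f = 0.
Proof. by move=> f0; apply: big1 => s _; rewrite f0 ?size_letters ?mulr0. Qed.

Lemma invsum0 f : invsum 0 f = f [::].
Proof.
have all1 (s : 'S_0) : s = 1%g by apply/permP => -[].
rewrite /invsum (bigD1 1%g) //= big1 => [|s /negP[]]; last by rewrite (all1 s).
have -> : letters (1%g : 'S_0) = [::] by apply/size0nil/size_letters.
have -> : ninv (1%g : 'S_0) = 0%N by rewrite ninvE big_ord0.
by rewrite mul1r addr0.
Qed.

(** Permutations are sorted by the position [i] of their smallest letter, which accounts for [i]
    inversions. *)
Lemma invsumS n f :
  invsum n.+1 f = \sum_(i < n.+1) qvar ^+ i * invsum n (fun w => f (ins i w)).
Proof.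
rewrite /invsum (partition_big (fun s : 'S_n.+1 => s^-1%g ord0) xpredT) //=.
apply: eq_bigr => i _; rewrite mulr_sumr.
transitivity (\sum_(s : 'S_n.+1 | s i == ord0) qvar ^+ ninv s * f (letters s)).
  by apply: eq_bigl => s; rewrite (canF_eq (permKV s)) eq_sym.
rewrite reindex_lift; apply: eq_bigr => s _.
by rewrite ninv_lift letters_lift exprD mulrA.
Qed.

Definition order_invariant (f : seq nat -> Zqz) : Prop :=
  forall h : nat -> nat, {mono h : x y / (x < y)%N} ->
  forall w, f (map h w) = f w.

Lemma order_invariant_ins f i :
  order_invariant f -> order_invariant (fun w => f (ins i w)).
Proof.
move=> inv_f h mono_h w.
(* Fixing the new 0 and acting as [h] on the shifted letters makes [h'] compatible with [ins i]. *)
pose h' x := if x is y.+1 then (h y).+1 else 0%N.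
have mono_h' : {mono h' : x y / (x < y)%N}.
  by move=> [|x] [|y] //=; rewrite !ltnS mono_h.
rewrite -(inv_f h' mono_h' (ins i w)) /ins map_cat /= map_take map_drop.
by rewrite -!map_comp.
Qed.

Lemma take_ins_le i k w : (i <= k)%N -> (k <= size w)%N ->
  take k.+1 (ins i w) = ins i (take k w).
Proof.
move=> le_ik le_kw; rewrite /ins take_cat size_take size_map.
have -> : (if i < size w then i else size w)%N = i by case: ltngtP; lia.
rewrite ltnNge leqW //= subSn //= map_take; congr (_ ++ _ :: _).
  by rewrite take_takel.
by rewrite take_drop subnK.
Qed.

Lemma drop_ins_le i k w : (i <= k)%N -> (k <= size w)%N ->
  drop k.+1 (ins i w) = map S (drop k w).
Proof.
move=> le_ik le_kw; rewrite /ins drop_cat size_take size_map.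
have -> : (if i < size w then i else size w)%N = i by case: ltngtP; lia.
by rewrite ltnNge leqW //= subSn //= drop_drop subnK // map_drop.
Qed.

Lemma take_ins_ge i k w : (k <= i)%N -> (i <= size w)%N ->
  take k (ins i w) = map S (take k w).
Proof.
move=> le_ki le_iw; rewrite /ins take_cat size_take size_map.
have -> : (if i < size w then i else size w)%N = i by case: ltngtP; lia.
case: ltngtP le_ki => // [lt_ki _|-> _]; first by rewrite take_takel ?map_take // ltnW.
by rewrite subnn /= cats0 map_take.
Qed.

Lemma drop_ins_ge i k w : (k <= i)%N -> (i <= size w)%N ->
  drop k (ins i w) = ins (i - k) (drop k w).
Proof.
move=> le_ki le_iw; rewrite /ins drop_cat size_take size_map.
have -> : (if i < size w then i else size w)%N = i by case: ltngtP; lia.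
rewrite !map_drop drop_drop subnK //.
case: ltngtP le_ki => // [lt_ki _|-> _]; last by rewrite subnn take0.
by rewrite take_drop subnK // ltnW.
Qed.

Lemma invsumZ n c f : invsum n (fun w => c * f w) = c * invsum n f.
Proof. by rewrite mulr_sumr; apply: eq_bigr => s _; rewrite mulrCA. Qed.

Lemma invsumB n f g :
  invsum n (fun w => f w - g w) = invsum n f - invsum n g.
Proof. by rewrite -sumrB; apply: eq_bigr => s _; rewrite mulrBr. Qed.

Lemma invsum_sum n m (F : nat -> seq nat -> Zqz) :
  invsum n (fun w => \sum_(k < m) F k w) = \sum_(k < m) invsum n (F k).
Proof. by rewrite exchange_big; apply: eq_bigr => s _; rewrite mulr_sumr. Qed.

Lemma gaussn0 n : gauss n 0 = 1.
Proof. by case: n. Qed.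

Lemma gaussnn n : gauss n n = 1.
Proof. by elim: n => //= n ->; rewrite gauss_small // mulr0 addr0. Qed.

(* Removing the smallest letter of a word turns the q-Pascal rule into an
   induction step: the letter lies in the prefix or in the suffix. *)
Lemma invsum_shuffle k m f g : order_invariant f -> order_invariant g ->
  invsum (k + m) (fun w => f (take k w) * g (drop k w))
    = gauss (k + m) k * (invsum k f * invsum m g).
Proof.
have [n] := ubnP (k + m); elim: n k m f g => // n IHn [|k] [|m] f g lt_n inv_f inv_g.
- by rewrite !invsum0 mul1r.
- rewrite gaussn0 mul1r invsum0 -invsumZ.
  by apply: eq_invsum => w _ _; rewrite take0 drop0.
- rewrite addn0 gaussnn mul1r invsum0 mulrC -invsumZ; apply: eq_invsum => w sz_w _.
  by rewrite -sz_w take_size drop_size mulrC.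
(* The minimum lies at one of the first k+1 positions (prefix) or the last m+1 (suffix): these are
   the two terms of q-Pascal. *)
rewrite addSn invsumS -addSn big_split_ord /= mulrDl; congr (_ + _).
  rewrite [invsum k.+1 f]invsumS mulr_suml mulr_sumr; apply: eq_bigr => i _.
  transitivity (qvar ^+ i * (gauss (k + m.+1) k
      * (invsum k (fun w => f (ins i w)) * invsum m.+1 g))); last by ring.
  rewrite -IHn //; last by exact: order_invariant_ins.
  congr (_ * _); apply: eq_invsum => w sz_w _.
  have le_ik : (i <= k)%N by rewrite -ltnS.
  have le_kw : (k <= size w)%N by rewrite sz_w leq_addr.
  by rewrite take_ins_le // drop_ins_le // inv_g.
rewrite addnS [invsum m.+1 g]invsumS !mulr_sumr; apply: eq_bigr => i _.
transitivity (qvar ^+ (k.+1 + i) * (gauss (k.+1 + m) k.+1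
      * (invsum k.+1 f * invsum m (fun w => g (ins i w))))); last first.
  by rewrite exprD addSn; ring.
rewrite -IHn //; first last.
- exact: order_invariant_ins.
- by rewrite addSn -ltnS -addnS -addSn.
rewrite addSn; congr (_ * _); apply: eq_invsum => w sz_w _.
have le_iw : (k.+1 + i <= size w)%N by have := ltn_ord i; rewrite sz_w; lia.
rewrite take_ins_ge ?leq_addr // drop_ins_ge ?leq_addr // inv_f //.
by rewrite subSS addKn.
Qed.

(** * Convolution of factors sharing one letter *)

Lemma count_le_succ x w :
  count (fun y => (y <= x.+1)%N) (map S w) = count (fun y => (y <= x)%N) w.
Proof. by rewrite count_map; apply: eq_count. Qed.

Lemma count_ins (P : pred nat) i w :
  count P (ins i w) = (P 0%N + count P (map S w))%N.
Proof. by rewrite /ins count_cat /= addnCA -count_cat cat_take_drop. Qed.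

Lemma last_ins i w : (i < size w)%N -> last 0%N (ins i w) = (last 0%N w).+1.
Proof.
move=> lt_iw; rewrite /ins last_cat /= -map_drop.
case: (lastP w) lt_iw => [|v x] //; rewrite size_rcons ltnS => le_iv.
by rewrite drop_rcons // map_rcons !last_rcons.
Qed.

Lemma last_ins_size w : last 0%N (ins (size w) w) = 0%N.
Proof. by rewrite /ins last_cat /= drop_oversize ?size_map. Qed.

(** For distinct letters this is the last letter of the standardization, so a match of length p has
    [rank_last] equal to tau_p. *)
Definition rank_last (w : seq nat) : nat :=
  count (fun y => (y <= last 0 w)%N) w.

(** In an overlap this forces the minimum of the suffix to be the shared letter. *)
Definition min_headed (f : seq nat -> Zqz) : Prop :=
  forall w, f w != 0 -> forall x, x \in w -> (head 0 w <= x)%N.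

Lemma min_headed_ins f i w : min_headed f -> (0 < i <= size w)%N -> f (ins i w) = 0.
Proof.
move=> hf /andP[i0 le_iw]; apply/eqP/negP => /negP /hf /(_ 0%N).
rewrite /ins mem_cat inE eqxx orbT => /(_ isT).
by case: w i le_iw i0 => [|x w] [|i].
Qed.

Lemma invsum_min_headed n f :
  min_headed f -> invsum n.+1 f = invsum n (fun w => f (ins 0 w)).
Proof.
move=> hf; rewrite invsumS big_ord_recl /= mul1r big1 ?addr0 // => i _.
rewrite invsum_eq0 ?mulr0 // => w sz_w.
by rewrite min_headed_ins //= sz_w ltn_ord.
Qed.

(* Smallest letter first: the e letters below the shared one lie in the prefix,
   after which the shared letter is the minimum and what remains is a shuffle. *)
Lemma invsum_overlap e d k f g :
    order_invariant f -> order_invariant g -> min_headed g ->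
    (forall w, size w = (e + d).+1 -> f w != 0 -> rank_last w = e.+1) ->
  invsum (e + d + k).+1 (fun w => f (take (e + d).+1 w) * g (drop (e + d) w))
    = gauss (d + k) d * (invsum (e + d).+1 f * invsum k.+1 g).
Proof.
elim: e f => [|e IHe] f inv_f inv_g hg hf.
- rewrite !add0n in hf *.
  (* For e = 0 the shared letter is the minimum of the prefix, so a 0 inserted before it kills
     [f]. *)
  have f_lt i w : (i < size w)%N -> size w = d -> f (ins i w) = 0.
    move=> lt_iw sz_w; apply/eqP/negP => /negP fw.
    have := hf _ _ fw; rewrite size_ins sz_w => /(_ erefl).
    rewrite /rank_last last_ins // count_ins count_le_succ add1n => -[] /eqP.
    rewrite -leqn0 leqNgt -has_count => /negP[]; apply/hasP.
    by exists (last 0%N w) => //; case: (w) lt_iw => //= x v _; apply: mem_last.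
  have -> : invsum d.+1 f = qvar ^+ d * invsum d (fun w => f (ins d w)).
    rewrite invsumS big_ord_recr /= big1 ?add0r // => i _.
    rewrite invsum_eq0 ?mulr0 // => w sz_w.
    by rewrite f_lt ?sz_w.
  rewrite (invsum_min_headed _ hg).
  transitivity (qvar ^+ d * (gauss (d + k) d
     * (invsum d (fun w => f (ins d w)) * invsum k (fun w => g (ins 0 w)))));
    last by ring.
  rewrite -invsum_shuffle; try exact: order_invariant_ins.
  have lt_d : (d < (d + k).+1)%N by rewrite ltnS leq_addr.
  (* Only position [d], the shared letter, can hold the minimum: an earlier one kills [f], a later
     one [g]. *)
  rewrite invsumS (bigD1 (Ordinal lt_d)) //= big1 ?addr0 => [|i].
    congr (_ * _); apply: eq_invsum => w sz_w _.
    have le_dw : (d <= size w)%N by rewrite sz_w leq_addr.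
    by rewrite take_ins_le // drop_ins_ge // subnn.
  rewrite -val_eqE /= => ne_id.
  rewrite invsum_eq0 ?mulr0 // => w sz_w.
  have le_dw : (d <= size w)%N by rewrite sz_w leq_addr.
  have le_iw : (i <= size w)%N by rewrite sz_w -ltnS ltn_ord.
  case: ltngtP ne_id => // [lt_id|lt_di] _.
    by rewrite take_ins_le ?(ltnW lt_id) // f_lt ?mul0r ?size_takel.
  rewrite drop_ins_ge ?(ltnW lt_di) // [g _]min_headed_ins ?mulr0 //.
  by rewrite subn_gt0 lt_di size_drop leq_sub2r.
(* Removing a minimum placed before the shared letter lowers its rank by one, which is the induction
   hypothesis on [e]. *)
have hf' i w : size w = (e + d).+1 -> (i < size w)%N -> f (ins i w) != 0 ->
    rank_last w = e.+1.
  move=> sz_w lt_iw /hf; rewrite size_ins sz_w => /(_ erefl).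
  by rewrite /rank_last last_ins // count_ins count_le_succ add1n => -[].
have f_last w : size w = (e + d).+1 -> f (ins (e + d).+1 w) = 0.
  move=> sz_w; apply/eqP/negP => /negP /hf; rewrite size_ins sz_w => /(_ erefl).
  rewrite /rank_last -sz_w last_ins_size count_ins count_map.
  by rewrite (@eq_count _ _ pred0) // count_pred0.
have -> : invsum (e.+1 + d).+1 f
    = \sum_(i < (e + d).+1) qvar ^+ i * invsum (e + d).+1 (fun w => f (ins i w)).
  rewrite invsumS big_ord_recr /= -[RHS]addr0; congr (_ + _).
  by rewrite invsum_eq0 ?mulr0.
have -> : (e.+1 + d + k).+1 = (e + d + k.+1).+1 by lia.
(* Now the minimum lies strictly before the shared letter: on it, [f] vanishes by [f_last], and
   after it, [g] vanishes. *)
rewrite invsumS -addSn big_split_ord /= [X in _ + X]big1 ?addr0 => [|i _].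
  rewrite mulr_suml mulr_sumr; apply: eq_bigr => i _.
  transitivity (qvar ^+ i * (gauss (d + k) d
     * (invsum (e + d).+1 (fun w => f (ins i w)) * invsum k.+1 g))); last by ring.
  have lei : (i <= e + d)%N by rewrite -ltnS.
  rewrite -IHe //; first last.
  - by move=> w sz_w; apply: hf'; rewrite ?sz_w.
  - exact: order_invariant_ins.
  rewrite [(_ + k.+1)%N]addnS; congr (_ * _); apply: eq_invsum => w sz_w _.
  have le_w : ((e + d).+1 <= size w)%N by rewrite sz_w; lia.
  by rewrite take_ins_le // 1?ltnW // drop_ins_le ?inv_g // ltnW.
rewrite invsum_eq0 ?mulr0 // => w sz_w.
have le_iw : ((e + d).+1 + i <= size w)%N by rewrite sz_w; have := ltn_ord i; lia.
case: (posnP i) => [i0|i_gt0].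
  rewrite i0 addn0 in le_iw *; rewrite take_ins_le //.
  by rewrite f_last ?mul0r // size_takel.
rewrite drop_ins_ge ?leq_addr // [g _]min_headed_ins ?mulr0 //.
by rewrite addKn i_gt0 size_drop; lia.
Qed.

(** * Standardization and descents of words *)

Definition rank (w : seq nat) (x : nat) : nat := count (fun y => (y <= x)%N) w.

Lemma redE w : red w = map (rank w) w.
Proof. by []. Qed.

Lemma size_red w : size (red w) = size w.
Proof. exact: size_map. Qed.

(** For y < x the letters up to y, together with x itself, are all counted in the rank of x, so that
    rank is strictly larger. *)
Lemma rank_mono w : {in w &, {mono rank w : x y / (x <= y)%N}}.
Proof.
move=> x y xw yw; have [le_xy|lt_yx] := leqP x y.
  by apply: sub_count => z /= le_zx; apply: leq_trans le_xy.
apply/negbTE; rewrite -ltnNge /rank.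
have disj : count (predI (fun z => (z <= y)%N) (pred1 x)) w = 0%N.
  apply/eqP; rewrite -leqn0 leqNgt -has_count; apply/hasPn => z _ /=.
  by case: eqP => [->|]; rewrite ?andbF // leqNgt lt_yx.
have := count_predUI (fun z => (z <= y)%N) (pred1 x) w.
rewrite disj addn0 => cU; apply: (@leq_trans (count (predU (leq^~ y) (pred1 x)) w)).
  by rewrite cU -addn1 leq_add2l -has_count has_pred1.
by apply: sub_count => z /= /orP[le_zy|/eqP-> //]; apply: leq_trans (ltnW lt_yx).
Qed.

Lemma rank_gt0 w x : x \in w -> (0 < rank w x)%N.
Proof. by move=> xw; rewrite -has_count; apply/hasP; exists x. Qed.

Lemma red_map h w : {in w &, {mono h : x y / (x <= y)%N}} -> red (map h w) = red w.
Proof.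
move=> mono_h; rewrite /red -map_comp; apply/eq_in_map => x xw /=.
by rewrite count_map; apply: eq_in_count => y yw /=; rewrite mono_h.
Qed.

Lemma mono_in h (w : seq nat) : {mono h : x y / (x < y)%N} ->
  {in w &, {mono h : x y / (x <= y)%N}}.
Proof. by move=> mono_h x y _ _; rewrite leqNgt mono_h -leqNgt. Qed.

Lemma red_take_drop_red k i w : red (take k (drop i (red w))) = red (take k (drop i w)).
Proof.
rewrite [red w]redE -map_drop -map_take red_map // => x y xw yw.
by rewrite rank_mono //; [move: xw|move: yw] => /mem_take/mem_drop.
Qed.

(** The letters are a rearrangement of 0, ..., n-1, so exactly v+1 of them are at most v. *)
Lemma red_letters n (s : 'S_n) : red (letters s) = word s.
Proof.
rewrite wordE; apply/eq_in_map => x /mapP[i _ ->].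
have sub : {subset letters s <= iota 0 n}.
  by move=> y /mapP[j _ ->]; rewrite mem_iota /= add0n ltn_ord.
have [|_ eq_mem] := uniq_min_size (letters_uniq s) sub.
  by rewrite size_iota size_letters.
have /seq.permP -> : perm_eq (letters s) (iota 0 n).
  by apply: uniq_perm; rewrite ?letters_uniq ?iota_uniq.
have -> : iota 0 n = iota 0 ((s i).+1 + (n - (s i).+1)) by rewrite subnKC.
rewrite iotaD count_cat add0n; set a := count _ _; set b := count _ _.
have -> : a = (s i).+1.
  rewrite /a -[RHS](size_iota 0); apply/eqP; rewrite -all_count.
  by apply/allP => y; rewrite mem_iota.
suff -> : b = 0%N by rewrite addn0.
apply/eqP; rewrite -leqn0 leqNgt -has_count; apply/hasPn => y.
by rewrite mem_iota -ltnNge => /andP[].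
Qed.

(** This turns a factor of a word into a permutation, to which the minimal overlapping property
    applies. *)
Lemma standardization (w : seq nat) : uniq w -> exists s : 'S_(size w), word s = red w.
Proof.
move=> uniq_w; set n := size w.
have lt_f (i : 'I_n) : ((rank w (nth 0 w i)).-1 < n)%N.
  by rewrite prednK ?rank_gt0 ?mem_nth ?count_size.
have inj_f : injective (fun i => Ordinal (lt_f i)).
  move=> i j /(congr1 val) /= eq_ij; apply/val_inj/eqP.
  rewrite -(nth_uniq 0%N (ltn_ord i) (ltn_ord j) uniq_w) eqn_leq.
  have [iw jw] : nth 0%N w i \in w /\ nth 0%N w j \in w by rewrite !mem_nth.
  rewrite -(rank_mono iw jw) -(rank_mono jw iw) -eqn_leq.
  by rewrite -(prednK (rank_gt0 iw)) eq_ij prednK ?rank_gt0.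
exists (perm inj_f); apply: (@eq_from_nth _ 0%N);
  rewrite wordE size_map size_letters ?size_red //.
move=> i lt_iw; have -> : i = Ordinal lt_iw by [].
rewrite -wordE nth_word permE /= prednK ?rank_gt0 ?mem_nth //.
by rewrite (nth_map 0%N).
Qed.

(** The default [head x r] is x when r is empty, so the last letter adds no descent. *)
Fixpoint des (w : seq nat) : nat :=
  if w is x :: r then ((head x r < x) + des r)%N else 0%N.

Lemma des_map h w : {in w &, {mono h : x y / (x <= y)%N}} -> des (map h w) = des w.
Proof.
elim: w => //= x r IHr mono_h; rewrite IHr; last first.
  by move=> y z yr zr; apply: mono_h; rewrite inE ?yr ?zr orbT.
congr (_ + _)%N; case: r {IHr} mono_h => [|y r] mono_h /=; first by rewrite !ltnn.
by rewrite !ltnNge mono_h ?inE ?eqxx ?orbT.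
Qed.

Lemma des_red w : des (red w) = des w.
Proof. exact/des_map/rank_mono. Qed.

Lemma desE w : des w = (\sum_(i < (size w).-1) (nth 0 w i.+1 < nth 0 w i))%N.
Proof.
elim: w => [|x [|y r] IHr]; rewrite /= ?big_ord0 ?ltnn //.
by rewrite big_ord_recl /= -[(_ + des r)%N]/(des (y :: r)) IHr.
Qed.

Lemma ndesE n (s : 'S_n) : ndes s = des (word s).
Proof.
rewrite desE wordE size_map size_letters -wordE /ndes -sum1_card big_mkcond /=.
by apply: eq_bigr => i _; rewrite inE; case: ifP.
Qed.

(** Since the two factors share the letter at position [k], every adjacent pair lies in exactly one
    of them. *)
Lemma des_take_drop k w : des w = (des (take k.+1 w) + des (drop k w))%N.
Proof.
elim: k w => [|k IHk] [|x [|y r]] //=; rewrite ?ltnn ?take0 //.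
by have := IHk (y :: r); rewrite /= => ->; rewrite addnA.
Qed.

(** * Matches, avoidance and clusters *)

Section Matches.
Context {p : nat} (tau : 'S_p).

Definition matches (w : seq nat) : bool := red (take p w) == word tau.

Lemma match_atE n (s : 'S_n) i : match_at tau s i = matches (drop i (letters s)).
Proof.
by rewrite /match_at /matches wordE -map_drop -map_take red_map // => x y _ _.
Qed.

Lemma matches_map h w : {mono h : x y / (x < y)%N} -> matches (map h w) = matches w.
Proof. by move=> mono_h; rewrite /matches -map_take red_map //; apply: mono_in. Qed.

Lemma matches_size w : matches w -> (p <= size w)%N.
Proof.
move=> /eqP /(congr1 size); rewrite size_red wordE size_map size_letters.
by rewrite size_take; case: ltnP => [/ltnW|_ ->].
Qed.

Lemma matches_take k w : matches (take k w) = (p <= k)%N && matches w.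
Proof.
have [le_pk|lt_kp] := leqP p k; first by rewrite /matches take_takel.
apply/negP => /matches_size; rewrite size_take; case: ltnP => //; lia.
Qed.

Fixpoint avoids (w : seq nat) : bool :=
  if w is x :: r then ~~ matches w && avoids r else true.

Lemma avoidsP w :
  reflect (forall i, (i < size w)%N -> ~~ matches (drop i w)) (avoids w).
Proof.
elim: w => [|x r IHr] /=; first by left.
apply: (iffP andP) => [[m0 /IHr mr] [|i] //= /mr //|mw].
by split; [exact: (mw 0%N)|apply/IHr => i; exact: (mw i.+1)].
Qed.

Lemma in_NM n (s : 'S_n) : (s \in NM tau n) = avoids (letters s).
Proof.
rewrite inE /nmatches cards_eq0; apply/eqP/avoidsP => [m0 i|m0].
  rewrite size_letters -match_atE => lt_in.
  by have /setP/(_ (Ordinal lt_in)) := m0; rewrite !inE => ->.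
by apply/setP => i; rewrite !inE match_atE; apply/negbTE/m0; rewrite size_letters.
Qed.

Lemma avoids_map h w : {mono h : x y / (x < y)%N} -> avoids (map h w) = avoids w.
Proof. by move=> mono_h; elim: w => //= x r ->; rewrite -map_cons matches_map. Qed.

(* Two matches of w at distance i < p - 1 chosen as close as possible give, after
   standardization, a permutation of length i + p with exactly two matches. *)
Lemma no_overlap (w : seq nat) i : minimal_overlapping tau -> uniq w -> matches w ->
  (0 < i < p.-1)%N -> ~~ matches (drop i w).
Proof.
move=> [_ min_tau] uniq_w m0 lt_ip; apply/negP => mi.
have ex : exists j, (0 < j < p.-1)%N && matches (drop j w) by exists i; rewrite lt_ip.
case: (ex_minnP ex) => {i lt_ip mi ex} i /andP[/andP[i_gt0 lt_ip] mi] min_i.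
have le_w : (i + p <= size w)%N.
  by have := matches_size mi; rewrite size_drop; lia.
set u := take (i + p) w.
have size_u : size u = (i + p)%N by rewrite size_takel.
have [s ws] := standardization (take_uniq (i + p) uniq_w : uniq u).
(* Cutting after i+p letters leaves no room for a match beyond position [i]. *)
have ms j : match_at tau s j = (j <= i)%N && matches (drop j w).
  rewrite /match_at ws red_take_drop_red -/(matches _).
  have [le_ji|lt_ij] := leqP j i.
    by rewrite /u /matches !take_drop take_takel // addnC leq_add2r.
  by apply/negP => /matches_size; rewrite size_drop size_u; lia.
suff /min_tau : exists s : 'S_(size u), nmatches tau s = 2 by rewrite size_u; lia.
exists s.
have lt0 : (0 < size u)%N by rewrite size_u; lia.
have lti : (i < size u)%N by rewrite size_u; lia.
rewrite /nmatches (_ : [set _ | _] = [set Ordinal lt0; Ordinal lti]).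
  by rewrite cards2 -val_eqE /= neq_ltn i_gt0.
apply/setP => j; rewrite !inE ms -!val_eqE /=.
case: (posnP j) => [->|j_gt0]; first by rewrite drop0 m0.
case: ltngtP => //= [lt_ji|->]; last by rewrite mi.
apply/negP => mj; suff : (i <= j)%N by rewrite leqNgt lt_ji.
by apply: min_i; rewrite j_gt0 mj (ltn_trans lt_ji lt_ip).
Qed.

(** No match starts at positions 1, ..., p-2 after one at 0, so these positions can be skipped, up
    to the last letter of the match. *)
Lemma avoids_drop (w : seq nat) j : minimal_overlapping tau -> uniq w -> matches w ->
  (j <= p.-2)%N -> avoids (drop 1 w) = avoids (drop j.+1 w).
Proof.
move=> min_tau uniq_w m0; elim: j => // j IHj lt_j; rewrite IHj 1?ltnW //.
have lt_jw : (j.+1 < size w)%N by have := matches_size m0; lia.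
rewrite (drop_nth 0%N lt_jw) /= -(drop_nth 0%N lt_jw) no_overlap //; lia.
Qed.

Definition avoid_weight (w : seq nat) : Zqz :=
  if w is [::] then 1 else (avoids w)%:R * zvar ^+ (des w).+1.

(** [N] is fuel, since [drop p.-1 w] is not a structural subterm. The term [nilp r] starts the
    chain: a single letter weighs z. *)
Fixpoint cluster_rec (N : nat) (w : seq nat) : Zqz :=
  if N is N'.+1 then if w is x :: r then
    (nilp r)%:R * zvar + (x < head x r)%N%:R * (1 - zvar) * cluster_rec N' r
      - (matches w)%:R * zvar ^+ ndes tau * cluster_rec N' (drop p.-1 w)
  else 0 else 0.

(* Signed weight of the ways to cover w by consecutive pieces sharing one letter,
   each a marked ascent (weight 1 - z) or a marked tau-match (weight
   - z^(des tau)): inclusion-exclusion on z = z and 1 = z + (1 - z) over the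
   adjacent pairs, and on 0 = 1 - 1 over the matches. *)
Definition cluster (w : seq nat) : Zqz := cluster_rec (size w) w.

Lemma size_drop_pred x r : (1 < p)%N -> (size (drop p.-1 (x :: r : seq nat)) <= size r)%N.
Proof. by rewrite size_drop /=; lia. Qed.

Lemma cluster_rec_fuel N M w : (1 < p)%N -> (size w <= N)%N -> (size w <= M)%N ->
  cluster_rec N w = cluster_rec M w.
Proof.
move=> p1; elim: N M w => [|N IHN] [|M] [|x r] //; rewrite /= !ltnS => lerN lerM.
have le_d := size_drop_pred x r p1.
by rewrite (IHN M r) // (IHN M (drop _ _)) // (leq_trans le_d).
Qed.

Lemma cluster_cons x r : (1 < p)%N ->
  cluster (x :: r) =
    (nilp r)%:R * zvar + (x < head x r)%N%:R * (1 - zvar) * cluster r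
      - (matches (x :: r))%:R * zvar ^+ ndes tau * cluster (drop p.-1 (x :: r)).
Proof.
move=> p1; rewrite {1}/cluster [size _]/= [cluster_rec _.+1 _]/=.
by congr (_ - _ * _); apply: cluster_rec_fuel => //; apply: size_drop_pred.
Qed.

Lemma order_invariant_cluster : (1 < p)%N -> order_invariant cluster.
Proof.
move=> p1 h mono_h w; have [n] := ubnP (size w).
elim: n w => // n IHn [|x r] //; rewrite ltnS => lt_n.
rewrite map_cons !cluster_cons // -map_cons -map_drop matches_map //.
rewrite IHn // IHn; last first.
  exact: leq_ltn_trans (size_drop_pred x r p1) lt_n.
rewrite /nilp size_map; congr (_ + _ * _ * _ - _).
by case: r {lt_n} => [|y r] /=; rewrite ?ltnn ?mono_h.
Qed.

Lemma order_invariant_avoid_weight : order_invariant avoid_weight.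
Proof.
move=> h mono_h [|x r] //; rewrite /avoid_weight map_cons -map_cons.
by rewrite avoids_map // des_map //; apply: mono_in.
Qed.

Lemma matches_min x r y : nth 0%N (word tau) 0 = 1%N ->
  matches (x :: r) -> y \in take p (x :: r) -> (x <= y)%N.
Proof.
move=> t1 /eqP E yu.
have [xu nth_u] : x \in take p (x :: r) /\ nth 0%N (take p (x :: r)) 0 = x.
  by case: (p) yu => //= k _; rewrite inE eqxx.
have u_gt0 : (0 < size (take p (x :: r)))%N by case: (take _ _) xu.
rewrite -E redE (nth_map 0%N) // nth_u in t1.
by rewrite -(rank_mono xu yu) t1 rank_gt0.
Qed.

(** The first letter of a link is its minimum, hence at most the shared letter, which by induction
    is minimal in the rest. *)
Lemma min_headed_cluster : (1 < p)%N -> nth 0%N (word tau) 0 = 1%N ->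
  min_headed cluster.
Proof.
move=> p1 t1 w; have [n] := ubnP (size w).
elim: n w => // n IHn [|x r] //; rewrite ltnS => lt_n.
rewrite cluster_cons //; case: (altP nilP) => [-> _ y|r_nz].
  by rewrite inE => /eqP ->.
rewrite mul0r add0r => c_nz /= y; rewrite inE => /predU1P[->//|yr].
(* Either nonzero term alone yields the bound, so cancellation between them is harmless. *)
have [/andP[m c_d]|] := boolP (matches (x :: r) && (cluster (drop p.-1 (x :: r)) != 0)).
  have le_pw := matches_size m; set w := x :: r in m c_d le_pw *.
  have head_u : head 0%N (drop p.-1 w) \in take p w.
    rewrite -nth0 nth_drop addn0 -(@nth_take p) ?mem_nth ?size_takel //; lia.
  have : y \in take p.-1 w ++ drop p.-1 w by rewrite cat_take_drop inE yr orbT.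
  rewrite mem_cat => /orP[yu|yd].
    apply: (matches_min t1 m); move: yu; rewrite -(take_takel w (leq_pred p)).
    exact: mem_take.
  apply: leq_trans (matches_min t1 m head_u) (IHn _ _ c_d _ yd).
  exact: leq_ltn_trans (size_drop_pred x r p1) lt_n.
rewrite negb_and negbK => no_m.
rewrite [X in _ - X](_ : _ = 0) ?subr0 in c_nz; last first.
  by case/orP: no_m => [/negbTE->|/eqP->]; rewrite ?mulr0 ?mul0r.
have lt_xr : (x < head x r)%N by case: ltnP c_nz => //; rewrite !mul0r eqxx.
have c_r : cluster r != 0 by apply: contraNneq c_nz => ->; rewrite mulr0.
have := IHn r lt_n c_r y yr; case: r r_nz {c_nz yr lt_n c_r no_m} lt_xr => //= z r _.
by move=> /ltnW; exact: leq_trans.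
Qed.

End Matches.

(** * Inclusion-exclusion on a single word *)

Section Inversion.
Context {p : nat} (tau : 'S_p).
Context (p1 : (1 < p)%N) (min_tau : minimal_overlapping tau).

Definition split_sum (w : seq nat) : Zqz :=
  \sum_(k < (size w).+1) cluster tau (take k w) * avoid_weight tau (drop k w).

(** A prefix containing the match has length p-1+j with j > 0. The term j = 0 may be added because
    the empty word has cluster weight 0. *)
Lemma split_sum_match w :
  \sum_(k < (size w).+1) (matches tau (take k w))%:R * cluster tau (drop p.-1 (take k w))
      * avoid_weight tau (drop k w)
    = (matches tau w)%:R * split_sum (drop p.-1 w).
Proof.
have [m|no_m] := boolP (matches tau w); last first.
  rewrite mul0r big1 // => k _.
  by rewrite matches_take (negbTE no_m) andbF !mul0r.
have le_pw := matches_size m; rewrite mul1r /split_sum size_drop.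
have -> : (size w).+1 = (p.-1 + (size w - p.-1).+1)%N by lia.
rewrite big_split_ord /= big1 ?add0r => [|k _].
  apply: eq_bigr => j _; rewrite matches_take m andbT.
  rewrite drop_drop /= addnC.
  rewrite -take_drop; case: (posnP j) => [->|j_gt0].
    by rewrite take0 /cluster /= !(mulr0, mul0r).
  by rewrite (_ : p <= j + p.-1)%N ?mul1r //; lia.
rewrite matches_take leqNgt (_ : k < p)%N ?mul0r //.
by have := ltn_ord k; rewrite /=; lia.
Qed.

(** Expanding the first link reduces the claim to shorter words. Without an initial match, an ascent
    gives z + (1 - z) = 1 and a descent z; with one, the terms must cancel. *)
Lemma split_sumE w : uniq w -> w != [::] -> split_sum w = avoid_weight tau w.
Proof.
have [n] := ubnP (size w); elim: n w => // n IHn [|x r] //; rewrite ltnS => lt_n.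
move=> uniq_w _; set w := x :: r in uniq_w *.
(* For empty [r] the two sums differ (0 and 1), but the ascent factor vanishes. *)
have IHr : (x < head x r)%N%:R * split_sum r = (x < head x r)%N%:R * avoid_weight tau r.
  have [->|r_nz] := eqVneq r [::]; first by rewrite /= ltnn !mul0r.
  by rewrite IHn //; case/andP: uniq_w.
have IHd : (matches tau w)%:R * split_sum (drop p.-1 w)
    = (matches tau w)%:R * avoid_weight tau (drop p.-1 w).
  case: (boolP (matches tau w)) => [/matches_size le_pw|]; last by rewrite !mul0r.
  rewrite IHn ?drop_uniq //; first exact: leq_ltn_trans (size_drop_pred x r p1) lt_n.
  by rewrite -size_eq0 size_drop subn_eq0 -ltnNge prednK // ltnW.
have -> : split_sum w = zvar * avoid_weight tau r
    + (1 - zvar) * ((x < head x r)%N%:R * split_sum r)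
    - zvar ^+ ndes tau * ((matches tau w)%:R * split_sum (drop p.-1 w)).
  have -> : split_sum w
      = \sum_(k < (size r).+1) cluster tau (x :: take k r) * avoid_weight tau (drop k r).
    by rewrite /split_sum big_ord_recl /= /cluster /= mul0r add0r.
  have -> : (matches tau w)%:R * split_sum (drop p.-1 w)
      = \sum_(k < (size r).+1) (matches tau (x :: take k r))%:R
          * cluster tau (drop p.-1 (x :: take k r)) * avoid_weight tau (drop k r).
    rewrite -split_sum_match big_ord_recl /= {1}/cluster.
    by rewrite /= mulr0 mul0r add0r.
  rewrite /split_sum.
  have -> : zvar * avoid_weight tau r
      = \sum_(k < (size r).+1) (nilp (take k r))%:R * zvar * avoid_weight tau (drop k r).
    rewrite big_ord_recl take0 drop0 /= mul1r big1 ?addr0 // => k _.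
    by rewrite /nilp size_takel // mul0r mul0r.
  rewrite !mulr_sumr -big_split /= -sumrB; apply: eq_bigr => k _.
  rewrite cluster_cons //.
  (* The heads differ only when the prefix is empty, and then its cluster weight is 0. *)
  have -> : (x < head x (take k r))%N%:R * (1 - zvar) * cluster tau (take k r)
     = (x < head x r)%N%:R * (1 - zvar) * cluster tau (take k r).
    by move: (nat_of_ord k) => j; case: j (r) => [|j] [|y v] //=;
      rewrite /cluster /= !mulr0.
  ring.
rewrite {}IHr {}IHd /avoid_weight -/w [in RHS]/w.
case: (boolP (matches tau w)) => [m|no_m]; last first.
  rewrite /= no_m /= mul0r mulr0 subr0.
  case: r lt_n @w uniq_w no_m => [|y r] lt_n w uniq_w no_m /=.
    by rewrite !ltnn mul0r mulr0 addr0 /= !mul1r mulr1.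
  have : x != y by move: uniq_w; rewrite /= inE negb_or -andbA => /and3P[].
  rewrite neq_ltn => /orP[lt_xy|lt_yx].
    rewrite lt_xy (ltnNge y) (ltnW lt_xy) /=; ring.
  rewrite lt_yx (ltnNge x) (ltnW lt_yx) /= add1n mul0r mulr0 addr0.
  by rewrite mulrCA -exprS.
have -> : avoids tau (x :: r) = false by rewrite /= -/w m.
rewrite mul0r mul1r.
have le_pw := matches_size m.
have nz_d : drop p.-1 w != [::].
  by rewrite -size_eq0 size_drop subn_eq0 -ltnNge prednK // ltnW.
case Ed : (drop p.-1 w) nz_d => [|y s] // _; rewrite -Ed.
(* Both tails have the same avoidance by minimal overlapping; with additivity of descents over the
   shared letter this gives the cancellation. *)
have av : avoids tau r = avoids tau (drop p.-1 w).
  have := @avoids_drop _ tau w p.-2 min_tau uniq_w m (leqnn _).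
  by rewrite prednK; [rewrite /= drop0|lia].
have dw : des w = (ndes tau + des (drop p.-1 w))%N.
  rewrite (des_take_drop p.-1) prednK ?(ltnW p1) //; congr (_ + _)%N.
  by rewrite ndesE -(eqP m) des_red.
case: r lt_n @w uniq_w av m le_pw Ed dw => [|z r] lt_n w uniq_w av m le_pw Ed dw.
  by move: (leq_trans p1 le_pw).
rewrite av; case: (avoids _ _); last by rewrite !mul0r !mulr0 addr0 subr0.
have : x != z by move: uniq_w; rewrite /= inE negb_or -andbA => /and3P[].
have {dw} : ((z < x) + des (z :: r) = ndes tau + des (drop p.-1 w))%N by rewrite -dw.
rewrite neq_ltn !mul1r => E /orP[lt_xz|lt_zx].
  move: E; rewrite /= lt_xz (ltnNge z) (ltnW lt_xz) /= add0n => ->.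
  rewrite -addnS exprD; ring.
move: E; rewrite /= lt_zx (ltnNge x) (ltnW lt_zx) /= add1n => E.
by rewrite mul0r mulr0 addr0 -exprS E -addnS exprD subrr.
Qed.

(** * Inversion of the generating series *)

Definition cluster_sum n := invsum n (cluster tau).
Definition avoid_sum n := invsum n (avoid_weight tau).

Lemma avoid_sum0 : avoid_sum 0 = 1.
Proof. by rewrite /avoid_sum invsum0. Qed.

Lemma avoid_sumE n : (0 < n)%N -> avoid_sum n = INMn tau n.
Proof.
move=> n0; rewrite /INMn big_mkcond; apply: eq_bigr => s _.
rewrite in_NM ndesE wordE des_map; last exact: mono_in.
have := size_letters s; rewrite /avoid_weight.
case: (letters s) => [|x r] sz_s; first by rewrite -sz_s in n0.
by case: ifP => _; rewrite ?mul0r ?mulr0 // mul1r mulrC.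
Qed.

(** For the q-exponential series A of [avoid_sum] and C of [cluster_sum] this reads A = 1 + C A,
    that is 1/A = 1 - C. *)
Lemma avoid_sum_rec n : (0 < n)%N ->
  avoid_sum n = \sum_(k < n.+1) gauss n k * (cluster_sum k * avoid_sum (n - k)).
Proof.
move=> n0; transitivity (invsum n split_sum).
  apply: eq_invsum => w sz_w uniq_w; rewrite split_sumE //.
  by rewrite -size_eq0 sz_w -lt0n.
transitivity (invsum n (fun w =>
    \sum_(k < n.+1) cluster tau (take k w) * avoid_weight tau (drop k w))).
  by apply: eq_invsum => w <-.
rewrite (invsum_sum n n.+1
  (fun k w => cluster tau (take k w) * avoid_weight tau (drop k w))).
apply: eq_bigr => k _.
have le_kn : (k <= n)%N by rewrite -ltnS.
have := @invsum_shuffle k (n - k) _ _ (@order_invariant_cluster _ tau p1)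
  (@order_invariant_avoid_weight _ tau).
by rewrite subnKC.
Qed.

Lemma cluster_sum0 : cluster_sum 0 = 0.
Proof. exact: invsum0. Qed.

(** This is the coefficient of t^n in the defining product, multiplied by [n]_q! to return to
    polynomials. *)
Lemma IU_convolution IU n : is_IU tau IU -> (0 < n)%N ->
  \sum_(k < n.+1) gauss n k * (IU k * avoid_sum (n - k)) = 0.
Proof.
move=> [IU0 /(_ n) E] n0.
have F0 m : (qfact m)%:F != 0 by rewrite tofrac_eq0 qfact_neq0.
have qegfE a b m : b 0%N = 1 -> (forall k, (0 < k)%N -> b k = a k) ->
    qegf a m = (b m)%:F / (qfact m)%:F.
  rewrite /qegf => b0 ba; case: m => [|m] /=; last by rewrite ba.
  by rewrite b0 qfact0 tofrac1 divr1.
apply/eqP; rewrite -tofrac_eq0 rmorph_sum /=; apply/eqP.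
apply: (mulIf (invr_neq0 (F0 n))); rewrite mul0r mulr_suml.
move: E; rewrite /fps_mul /fps_one eqn0Ngt n0 /= => E; apply: etrans E.
apply: eq_bigr => k _; have le_kn : (k <= n)%N by rewrite -ltnS.
rewrite (qegfE IU IU) // /INM (qegfE _ avoid_sum) ?avoid_sum0 //; last exact: avoid_sumE.
rewrite !rmorphM [X in X * _ / _]gaussE // /qbinom le_kn.
by rewrite (qegf_term _ _ _ _ (F0 n)).
Qed.

Lemma IU_cluster IU n : is_IU tau IU -> (0 < n)%N -> IU n = - cluster_sum n.
Proof.
move=> isIU; have [m] := ubnP n; elim: m n => // m IHm n; rewrite ltnS => le_nm n0.
have := IU_convolution isIU n0; have := avoid_sum_rec n0.
rewrite !big_ord_recr /= subnn gaussnn avoid_sum0 mulr1 !mul1r.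
case: n n0 le_nm => // n _ le_nm.
(* The terms k = 0 differ: IU_0 is 1, whereas the empty cluster sum is 0. *)
rewrite big_ord_recl [in X in _ -> X]big_ord_recl /= cluster_sum0 mul0r mulr0 add0r.
rewrite isIU.1 !mul1r !subn0 => E.
under eq_bigr => i _.
  rewrite IHm //; last by apply: leq_trans le_nm; rewrite ltnS.
  rewrite mulNr mulrN; over.
by rewrite sumrN E [X in X - _]addrC addrK mulr1 addrC => /eqP; rewrite addr_eq0 => /eqP.
Qed.

(** * Recursion for the cluster sums *)

Lemma cluster_sum1 : cluster_sum 1 = zvar.
Proof.
rewrite /cluster_sum invsumS big_ord1 mul1r invsum0 /= cluster_cons //=.
rewrite !mul0r addr0 mul1r; have -> : matches tau [:: 0%N] = false.
  by apply/negP => /matches_size /=; lia.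
by rewrite !mul0r subr0.
Qed.

(** An ascent is an overlap with e = 1 and d = 0: no letter above the shared one is free, so the
    q-binomial is 1. *)
Lemma invsum_ascent n : nth 0%N (word tau) 0 = 1%N ->
  invsum n.+2 (fun w => (head 0 w < nth 0 w 1)%N%:R * cluster tau (drop 1 w))
    = cluster_sum n.+1.
Proof.
move=> t1.
pose f (u : seq nat) : Zqz := if u is [:: x, y & _] then (x < y)%N%:R else 0.
have inv_f : order_invariant f.
  by move=> h mono_h [|x [|y u]] //=; rewrite mono_h.
have rank_f w : size w = (1 + 0).+1 -> f w != 0 -> rank_last w = 2%N.
  case: w => [|x [|y [|]]] //= _; rewrite /rank_last /= leqnn.
  by case: ltnP => [/ltnW ->|]; rewrite ?eqxx.
have := invsum_overlap n inv_f (@order_invariant_cluster _ tau p1)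
  (@min_headed_cluster _ tau p1 t1) rank_f.
rewrite !add0n !addn0 add1n gaussn0 mul1r.
have -> : invsum 2 f = 1.
  rewrite invsumS !big_ord_recl big_ord0 !invsumS !big_ord1 !invsum0 /=.
  by rewrite !expr0 !mulr0 !addr0 !mulr1.
rewrite mul1r => E; rewrite /cluster_sum -E; apply: eq_invsum => w sz_w _.
by case: w sz_w => [|x [|y w]].
Qed.

(** In length p the only match is [tau] itself. *)
Lemma matches_sum : invsum p (fun w => (matches tau w)%:R) = qvar ^+ ninv tau.
Proof.
rewrite /invsum (bigD1 tau) //= big1 ?addr0 => [|s ne_s].
  by rewrite /matches take_oversize ?size_letters // red_letters eqxx mulr1.
rewrite /matches take_oversize ?size_letters // red_letters.
by rewrite (inj_eq (@word_inj p)) (negbTE ne_s) mulr0.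
Qed.

Lemma rank_last_match s w : nth 0%N (word tau) p.-1 = s -> size w = p ->
  matches tau w -> rank_last w = s.
Proof.
move=> <- sz_w /eqP; rewrite take_oversize ?sz_w // => <-.
have p0 : (p.-1 < size w)%N by rewrite sz_w; lia.
by rewrite redE (nth_map 0%N) // /rank_last -nth_last sz_w.
Qed.

(** An overlap with e = s-1 and d = p-s, the numbers of letters of the match below and above the
    shared one. *)
Lemma invsum_match s k : nth 0%N (word tau) 0 = 1%N ->
    nth 0%N (word tau) p.-1 = s -> (0 < s <= p)%N ->
  invsum (p + k) (fun w => (matches tau w)%:R * cluster tau (drop p.-1 w))
    = qvar ^+ ninv tau * gauss (p + k - s) (p - s) * cluster_sum k.+1.
Proof.
move=> t1 tp /andP[s0 le_sp].
pose f (u : seq nat) : Zqz := (matches tau u)%:R.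
have inv_f : order_invariant f by move=> h mono_h w; rewrite /f matches_map.
have ep : (s.-1 + (p - s)).+1 = p by lia.
have rank_f w : size w = (s.-1 + (p - s)).+1 -> f w != 0 -> rank_last w = s.-1.+1.
  rewrite ep prednK // /f => sz_w; case: (boolP (matches tau w)); rewrite ?eqxx //.
  by move=> m _; apply: rank_last_match.
have := invsum_overlap k inv_f (@order_invariant_cluster _ tau p1)
  (@min_headed_cluster _ tau p1 t1) rank_f.
have -> : (s.-1 + (p - s) + k).+1 = (p + k)%N by lia.
have -> : (p - s + k)%N = (p + k - s)%N by lia.
rewrite ep; have -> : (s.-1 + (p - s))%N = p.-1 by lia.
rewrite matches_sum => E; rewrite mulrAC mulrC mulrA [gauss _ _ * _]mulrC -mulrA.
rewrite mulrCA -E.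
by apply: eq_invsum => w _ _; rewrite /f matches_take leqnn.
Qed.

(** The first link is an ascent or a match; for n > 1 the single-letter term is absent. *)
Lemma cluster_sum_rec s n : nth 0%N (word tau) 0 = 1%N ->
    nth 0%N (word tau) p.-1 = s -> (0 < s <= p)%N -> (1 < n)%N ->
  cluster_sum n = (1 - zvar) * cluster_sum n.-1
    - (p <= n)%N%:R * (zvar ^+ ndes tau * qvar ^+ ninv tau
         * gauss (n - s) (p - s) * cluster_sum (n - p + 1)).
Proof.
move=> t1 tp lt_s n1.
transitivity (invsum n (fun w =>
    (1 - zvar) * ((head 0 w < nth 0 w 1)%N%:R * cluster tau (drop 1 w))
    - zvar ^+ ndes tau * ((matches tau w)%:R * cluster tau (drop p.-1 w)))).
  apply: eq_invsum => w sz_w _; rewrite -{}sz_w in n1.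
  case: w n1 => [|x [|y r]] // _; rewrite cluster_cons //=; ring.
rewrite invsumB !invsumZ; case: n n1 => [|[|n]] // _.
rewrite invsum_ascent //; congr (_ - _).
have [le_pn|lt_np] := leqP p n.+2; last first.
  rewrite mul0r invsum_eq0 ?mulr0 // => w sz_w.
  case: (boolP (matches tau w)) => [/matches_size|]; last by rewrite mul0r.
  by rewrite sz_w leqNgt lt_np.
rewrite mul1r -{1 2}(subnKC le_pn) (invsum_match _ t1 tp) // addn1; ring.
Qed.

End Inversion.

Theorem theorem4p1 (p s : nat) (tau : 'S_p) (IU : nat -> {poly {poly int}})
    (hp : (3 <= p)%N) (hs : (2 <= s < p)%N)
    (htau1 : nth 0%N (word tau) 0 = 1%N) (htaup : nth 0%N (word tau) p.-1 = s)
    (htau : minimal_overlapping tau) (hIU : is_IU tau IU) :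
  IU 1%N = - zvar /\
  forall n : nat, (2 <= n)%N ->
    (IU n)%:F =
      ((1 - zvar) * IU n.-1)%:F
      - (zvar ^+ ndes tau * qvar ^+ ninv tau)%:F
        * qbinom (n - s) (p - s) * (IU (n - p + 1)%N)%:F.
Proof.
have p1 : (1 < p)%N by apply: ltnW.
have IUE n : (0 < n)%N -> IU n = - cluster_sum tau n by apply: IU_cluster.
split=> [|n n2]; first by rewrite IUE // cluster_sum1.
have lt_s : (0 < s <= p)%N by lia.
rewrite (IUE n) 1?ltnW // (cluster_sum_rec p1 htau1 htaup lt_s n2).
rewrite !IUE; [|lia|lia].
have [le_pn|lt_np] := leqP p n.
  rewrite -gaussE; last by lia.
  rewrite -!rmorphM -rmorphB /=; congr (_ %:F); ring.
(* Subtraction truncates at 0, but s < p still gives n-s < p-s, so the q-binomial is 0. *)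
rewrite /qbinom leqNgt (_ : n - s < p - s)%N /=; last by lia.
rewrite mulr0 mul0r subr0 mul0r subr0; congr (_ %:F); ring.
Qed.
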